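(* For every integer $n\geqslant1$, $|\mathrm{PEnd}(S_n)|=(n+1)^{n-1}+n^{n-1}+(n-1)2^{n-1}$.
   Context: For $n\geqslant1$, the star graph $S_n$ is the simple graph with vertex set $\{0,1,\ldots,n-1\}$ and edge set $E=\{\{0,i\}\mid 1\leqslant i\leqslant n-1\}$. For a finite simple graph $G=(V,E)$, $\mathrm{PEnd}(G)$ is the set of all partial endomorphisms of $G$, i.e. partial maps $\alpha:V\to V$ (including the empty one; written on the right) such that for all $u,v\in\mathrm{Dom}(\alpha)$, $\{u,v\}\in E$ implies $\{u\alpha,v\alpha\}\in E$. *)

(* Defs.v *)
From mathcomp Require Import all_boot.

Set Implicit Arguments.
Unset Strict Implicit.
Unset Printing Implicit Defensive.

Record sgraph (V : finType) := SGraph {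
  edges : {set {set V}};
  edges_card2 : forall e : {set V}, e \in edges -> #|e| = 2
}.

Definition star_edges (n : nat) : {set {set 'I_n}} :=
  [set e : {set 'I_n} | [exists z : 'I_n, exists i : 'I_n,
    [&& val z == 0, 1 <= val i & e == [set z; i]]]].

Lemma star_edges_card2 (n : nat) (e : {set 'I_n}) :
  e \in star_edges n -> #|e| = 2.
Proof.
rewrite inE => /existsP[z /existsP[i /and3P[/eqP z0 i_gt0 /eqP->]]].
by rewrite cards2 -val_eqE z0 neq_ltn i_gt0.
Qed.

Definition star (n : nat) : sgraph 'I_n := SGraph (@star_edges_card2 n).

(* A partial map V -> V is a total function V -> option V, with None outside  *)
(* its domain. When u and v are sent to the same x, [set x; x] is a singleton *)
(* and so is not an edge.                                                     *)
Definition PEnd (V : finType) (G : sgraph V) : {set {ffun V -> option V}} :=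
  [set a : {ffun V -> option V} |
    [forall u : V, forall v : V, forall x : V, forall y : V,
      [&& a u == Some x, a v == Some y & [set u; v] \in edges G]
        ==> ([set x; y] \in edges G)]].

(* Main.v *)
Require Import Defs.
From mathcomp Require Import all_boot.

(** A pair of vertices of the star is an edge exactly when one of them is the
    centre [0] and the other is not.  Hence a partial map [a] is an endomorphism
    iff each leaf is sent into a set of values that depends on [a 0] only:
    anything if [0] is outside the domain, anything but [0] if [0] is fixed, and
    nothing or [0] if [0] is sent to a leaf.  Counting the maps with a given
    [a 0] gives the three summands. *)

Lemma star_edgeE (m : nat) (u v : 'I_m.+1) :
  ([set u; v] \in edges (star m.+1)) = ((u == ord0) (+) (v == ord0)).
Proof.
rewrite inE; apply/idP/idP => [|uv].
  case/existsP=> z /existsP[i /and3P[z0 i_gt0 /eqP uvE]].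
  have {}z0 : z = ord0 by apply/val_inj/eqP.
  have iN0 : i != ord0 by rewrite -val_eqE -lt0n.
  (* Equal unordered pairs may match in either order, so only the membership of [ord0] and [i] in
     [[set u; v]] is used. *)
  have := set22 z i; have := set21 z i; rewrite -uvE z0 => /set2P[] <-.
    by rewrite eqxx => /set2P[iE|<-]; [rewrite iE eqxx in iN0 | rewrite (negbTE iN0)].
  by rewrite eqxx => /set2P[<-|iE]; [rewrite (negbTE iN0) | rewrite iE eqxx in iN0].
have edge0 (i : 'I_m.+1) : i != ord0 -> [exists z : 'I_m.+1, exists j : 'I_m.+1,
    [&& val z == 0, 1 <= val j & [set ord0; i] == [set z; j]]].
  by rewrite -val_eqE -lt0n => i0; apply/existsP; exists ord0; apply/existsP; exists i;
    rewrite /= i0 eqxx.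
move: uv; case: (eqVneq u ord0) => [->|u0]; case: (eqVneq v ord0) => [->|v0] // _.
  exact: edge0.
by rewrite setUC; exact: edge0.
Qed.

Definition leaf_values (m : nat) (x : option 'I_m.+1) : {set option 'I_m.+1} :=
  if x is Some j then
    if j == ord0 then [set~ Some ord0] else [set None; Some ord0]
  else setT.

(** Pinning the centre to [x] turns the maps with [a ord0 = x] into a [family], whose cardinality is
    a product over the vertices. *)
Definition star_values (m : nat) (x : option 'I_m.+1) (i : 'I_m.+1) :
    {set option 'I_m.+1} :=
  if i == ord0 then [set x] else leaf_values m x.

(** Only pairs of the centre and a leaf are edges, so each leaf is constrained independently of the
    others. With [a ord0] as parameter, the family's condition at the centre holds trivially. *)
Lemma PEnd_starE (m : nat) (a : {ffun 'I_m.+1 -> option 'I_m.+1}) :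
  (a \in PEnd (star m.+1)) = (a \in family (star_values m (a ord0))).
Proof.
rewrite inE; apply/forallP/familyP => [aP i | aP u].
  rewrite /star_values; case: eqVneq => [->|i0]; first by rewrite inE.
  rewrite /leaf_values; case a0: (a ord0) => [x|]; last by rewrite inE.
  case ai: (a i) => [y|]; last by case: ifP; rewrite !inE.
  have /forallP/(_ i)/forallP/(_ x)/forallP/(_ y) := aP ord0.
  rewrite a0 ai !star_edgeE (negbTE i0) !eqxx /=.
  by case: (eqVneq x ord0) => x0; rewrite !inE ?(inj_eq Some_inj) //=; case: (y == ord0).
have edge0 (i x y : 'I_m.+1) : i != ord0 -> a ord0 = Some x -> a i = Some y ->
    (x == ord0) (+) (y == ord0).
  move=> i0 a0 ai; have := aP i; rewrite /star_values (negbTE i0) a0 ai /leaf_values.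
  by case: (eqVneq x ord0) => x0; rewrite !inE ?(inj_eq Some_inj) //=; case: (y == ord0).
apply/forallP=> v; apply/forallP=> x; apply/forallP=> y.
apply/implyP=> /and3P[/eqP au /eqP av]; rewrite !star_edgeE.
case: (eqVneq u ord0) au => [->|u0] au; case: (eqVneq v ord0) av => [->|v0] av // _.
  exact: edge0 v0 au av.
by rewrite addbC; exact: edge0 u0 av au.
Qed.

Lemma card_star_family (m : nat) (x : option 'I_m.+1) :
  #|family (star_values m x)| = #|leaf_values m x| ^ m.
Proof.
rewrite card_family foldrE big_map big_enum big_ord_recl /star_values eqxx cards1 /= mul1n.
by rewrite (eq_bigr (fun=> #|leaf_values m x|)) // prod_nat_const card_ord.
Qed.

Lemma card_PEnd_star (m : nat) :
  #|PEnd (star m.+1)| = \sum_(x : option 'I_m.+1) #|leaf_values m x| ^ m.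
Proof.
rewrite -sum1_card (partition_big (fun a : {ffun 'I_m.+1 -> option 'I_m.+1} => a ord0) xpredT) //=.
apply: eq_bigr => x _; rewrite sum1_card -card_star_family; apply: eq_card => a.
rewrite !inE -[_ \in _]/((a \in PEnd (star m.+1)) && (a ord0 == x)) PEnd_starE.
apply/andP/idP=> [[aP /eqP<-] // | aP].
(* The family allows only the singleton [[set x]] at the centre. *)
have /eqP a0 : a ord0 == x by have /familyP/(_ ord0) := aP; rewrite inE.
by rewrite a0.
Qed.

Theorem corollary1p5 (n : nat) (hn : 1 <= n) :
  #|PEnd (star n)| = (n + 1) ^ (n - 1) + n ^ (n - 1) + (n - 1) * 2 ^ (n - 1).
Proof.
case: n hn => // m _; rewrite subn1 addn1 card_PEnd_star /=.
(* Here [n] is [m.+1], and [option 'I_m.+1] has [m.+2] elements, whence the bases [n + 1] and,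
   without [Some ord0], [n]. *)
rewrite (bigD1 None) //= (bigD1 (Some ord0)) //= addnA; congr (_ + _ + _).
- by rewrite cardsT card_option card_ord.
- by rewrite cardsC1 card_option card_ord.
rewrite (eq_bigr (fun=> 2 ^ m)) => [|[j|] //]; last first.
  by rewrite (inj_eq Some_inj) => /= /negbTE->; rewrite cards2.
rewrite sum_nat_const; congr (_ * _).
(* The remaining indices are the complement of two elements among [m.+2], so there are [m] of
   them. *)
have := cardC (pred2 None (Some (@ord0 m))); rewrite card2 card_option card_ord /= => cE.
apply: (@addnI 2); apply: etrans cE.
by congr (_ + _); apply: eq_card => y; rewrite !inE negb_or.
Qed.
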